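(* Let $r\ge 2$, let $\mathcal{H}_r\subset\mathbb{P}^{r+1}$ be the Hermitian hypersurface over $\mathbb{F}_{q^2}$, and let $\delta\in\mathbb{F}_{q^2}$ satisfy $\delta^{q+1}=-1$. One can construct an order domain $R$ from $\mathcal{H}_r$, namely an order function on the affine coordinate ring $R$ of $\mathcal{H}_r\setminus V(X_0)$ over $\mathbb{F}_{q^2}$, with value semigroup in $\mathbb{Z}^r$ (ordered lexicographically) generated by $$(1,0,0,\ldots,0),\ (1,-1,0,\ldots,0),\ (1,0,-1,0,\ldots,0),\ \ldots,\ (1,0,0,\ldots,0,-1),\ (1,0,0,\ldots,0,-(q+1)),$$ i.e. by $e_1$, $e_1-e_i$ for $2\le i\le r$, and $e_1-(q+1)e_r$, where $e_1,\dots,e_r$ is the standard basis of $\mathbb{Z}^r$, and with a presentation of the form $$R\cong\mathbb{F}_{q^2}[X_1,\ldots,X_{r-1},X_{r+1},U]/\langle F\rangle,$$ where $$F=X_{r+1}^{q+1}+\delta^qX_{r-1}^qU+\delta X_{r-1}U^q+\sum_{j=1}^{r-2}X_j^{q+1}-U^{q+1}-1.$$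
   Context: $q$ is a prime power. The Hermitian hypersurface is $\mathcal{H}_r=V(X_0^{q+1}+X_1^{q+1}+\cdots+X_r^{q+1}+X_{r+1}^{q+1})\subset\mathbb{P}^{r+1}$ over $\mathbb{F}_{q^2}$. Order domain (over a finite field $k$, here $k=\mathbb{F}_{q^2}$): Let $R$ be a commutative $k$-algebra and let $(\Gamma,+,\succ)$ be a well-ordered commutative semigroup (the order is compatible with addition: $\alpha \prec \beta$ implies $\alpha+\gamma \prec \beta+\gamma$). An order function on $R$ is a surjective mapping $\rho : R \to \{-\infty\}\cup\Gamma$ satisfying: (i) $\rho(f) = -\infty \Leftrightarrow f=0$; (ii) $\rho(cf)=\rho(f)$ for all $f \in R$ and all $c\neq 0$ in $k$; (iii) $\rho(f+g) \preceq \max_\succ\{\rho(f),\rho(g)\}$ for all $f,g\in R$; (iv) if $\rho(f)=\rho(g)\ne -\infty$, then there exists $c\neq 0$ in $k$ such that $\rho(f-cg) \prec \rho(f)$; (v) $\rho(fg)=\rho(f)+\rho(g)$. $\Gamma$ is called the value semigroup, and $R$ together with $\rho$ is an order domain. *)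

(* Defs.v *)
From HB Require Import structures.
From mathcomp Require Import all_boot all_order all_algebra ring_quotient.
From mathcomp Require Import boolp.
From mathcomp Require Import mpoly zify.

Set Implicit Arguments.
Unset Strict Implicit.
Unset Printing Implicit Defensive.

Import GRing.Theory.
Local Open Scope ring_scope.
Local Open Scope quotient_scope.

Record well_ordered_semigroup (G : addSemigroupType) (lt : rel G) : Prop := {
  wo_irr : irreflexive lt;
  wo_trans : transitive lt;
  wo_total : forall a b, a != b -> lt a b || lt b a;
  wo_wf : well_founded (fun a b => lt a b);
  wo_add : forall a b c, lt a b -> lt (a + c) (b + c) }.

Section MinusInfinity.
Variables (G : addSemigroupType) (lt : rel G).

(* [option G] stands for {-oo} \cup G, with [None] as -oo. *)
Definition oo_lt : rel (option G) := fun u v =>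
  match u, v with
  | Some a, Some b => lt a b
  | None, Some _ => true
  | _, None => false
  end.

Definition oo_le : rel (option G) := fun u v => (u == v) || oo_lt u v.

Definition oo_max (u v : option G) : option G := if oo_lt u v then v else u.

Definition oo_add (u v : option G) : option G :=
  match u, v with
  | Some a, Some b => Some (a + b)
  | _, _ => None
  end.

End MinusInfinity.

Record order_function (k : fieldType) (R : comAlgType k)
    (G : addSemigroupType) (lt : rel G) (rho : R -> option G) : Prop := {
  rho_surj : forall v : option G, exists f, rho f = v;
  rho_ninfty : forall f, rho f = None <-> f = 0;
  rho_scale : forall (f : R) (c : k), c != 0 -> rho (c *: f) = rho f;
  rho_add : forall f g, oo_le lt (rho (f + g)) (oo_max lt (rho f) (rho g));
  rho_cancel : forall f g, rho f = rho g -> rho f <> None ->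
    exists2 c : k, c != 0 & oo_lt lt (rho (f - c *: g)) (rho f);
  rho_mul : forall f g, rho (f * g) = oo_add (rho f) (rho g) }.

Definition order_domain (k : fieldType) (R : comAlgType k)
    (G : addSemigroupType) (lt : rel G) (rho : R -> option G) : Prop :=
  well_ordered_semigroup lt /\ order_function lt rho.

Section Generated.
Variables (M : zmodType) (s : seq M).

(* The zero combination is allowed: the value semigroup of an order domain
   always contains rho 1 = 0. *)
Definition generated : {pred M} :=
  fun a => `[< exists c : 'I_(size s) -> nat, a = \sum_(i < size s) s`_i *+ c i >].

Fact generated_nmod_closed : Algebra.nmod_closed generated.
Proof.
split=> [|a b /asboolP[c ->] /asboolP[d ->]]; apply/asboolP.
  by exists (fun=> 0%N); rewrite big1.
exists (fun i => (c i + d i)%N).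
by rewrite -big_split /=; apply: eq_bigr => i _; rewrite mulrnDr.
Qed.

Record generated_semigroup := GeneratedSemigroup {
  gsval :> M; _ : gsval \in generated }.

HB.instance Definition _ := [isSub for gsval].
HB.instance Definition _ := [Choice of generated_semigroup by <:].
HB.instance Definition _ :=
  GRing.SubChoice_isSubNmodule.Build M generated generated_semigroup
    generated_nmod_closed.

End Generated.

Definition lex_lt (r : nat) : rel 'rV[int]_r := fun a b =>
  [exists i : 'I_r, [forall j : 'I_r, (j < i)%N ==> (a 0 j == b 0 j)]
             && (a 0 i < b 0 i)].

(* Standard basis, indexed from 1: [stdb r i] is e_i for 1 <= i <= r. *)
Definition stdb (r i : nat) : 'rV[int]_r := \row_(j < r) (j.+1 == i)%:R.

Definition value_gens (q r : nat) : seq 'rV[int]_r :=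
  stdb r 1 ::
  rcons [seq stdb r 1 - stdb r i | i <- iota 2 r.-1]
        (stdb r 1 - stdb r r *+ q.+1).

Definition value_semigroup (q r : nat) := generated_semigroup (value_gens q r).

HB.instance Definition _ q r := GRing.Nmodule.on (value_semigroup q r).

Definition value_lt (q r : nat) : rel (value_semigroup q r) :=
  fun a b => lex_lt (gsval a) (gsval b).

Section PrincipalIdeal.
Variables (k : comNzRingType) (A : comUnitAlgType k) (f : A).

Definition principal_mem : {pred A} := fun a => `[< exists b, a = b * f >].

(* The argument [fNU] makes the ideal proper, as required by [idealr]. *)
Definition principal (fNU : f \isn't a GRing.unit) : {pred A} := principal_mem.

Variable fNU : f \isn't a GRing.unit.

Fact principal_idealr_closed : idealr_closed (principal fNU).
Proof.
split=> [||a u v /asboolP[b ->] /asboolP[c ->]].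
- by apply/asboolP; exists 0; rewrite mul0r.
- apply/asboolPn => -[b b1]; move/negP: fNU; apply.
  by apply/unitrP; exists b; rewrite [f * b]mulrC -b1.
- by apply/asboolP; exists (a * b + c); rewrite mulrDl mulrA.
Qed.

HB.instance Definition _ :=
  isIdealr.Build A (principal fNU) principal_idealr_closed.

Definition principal_quot : Type := {ideal_quot (principal fNU)}.

HB.instance Definition _ := GRing.ComNzRing.on principal_quot.
HB.instance Definition _ := NzRingQuotient.on principal_quot.

Definition pquot_scale (c : k) (x : principal_quot) : principal_quot :=
  \pi_principal_quot (c *: repr x).

Fact pquotW (P : principal_quot -> Prop) :
  (forall a, P (\pi_principal_quot a)) -> forall x, P x.
Proof. by move=> Ppi x; rewrite -[x]reprK. Qed.

Fact pi_scale (c : k) (a : A) :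
  pquot_scale c (\pi_principal_quot a) = \pi_principal_quot (c *: a).
Proof.
rewrite /pquot_scale -[c *: repr _]mulr_algl -[c *: a]mulr_algl.
by rewrite !(rmorphM \pi_principal_quot); congr (_ * _); apply: reprK.
Qed.

Fact pquot_scaleA a b x :
  pquot_scale a (pquot_scale b x) = pquot_scale (a * b) x.
Proof. by elim/pquotW: x => x; rewrite !pi_scale scalerA. Qed.

Fact pquot_scale1 : left_id 1 pquot_scale.
Proof. by elim/pquotW => x; rewrite pi_scale scale1r. Qed.

Fact pquot_scaleDr : right_distributive pquot_scale +%R.
Proof.
move=> c; elim/pquotW => x; elim/pquotW => y.
by rewrite -(rmorphD \pi_principal_quot) !pi_scale scalerDr (rmorphD \pi_principal_quot).
Qed.

Fact pquot_scaleDl x : {morph pquot_scale^~ x : a b / a + b}.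
Proof. by elim/pquotW: x => x a b; rewrite !pi_scale scalerDl (rmorphD \pi_principal_quot). Qed.

HB.instance Definition _ := GRing.Zmodule_isLmodule.Build k principal_quot
  pquot_scaleA pquot_scale1 pquot_scaleDr pquot_scaleDl.

Fact pquot_scaleAl (c : k) (x y : principal_quot) :
  pquot_scale c (x * y) = pquot_scale c x * y.
Proof.
elim/pquotW: x => x; elim/pquotW: y => y; rewrite -(rmorphM \pi_principal_quot).
by rewrite !pi_scale scalerAl (rmorphM \pi_principal_quot).
Qed.

HB.instance Definition _ :=
  GRing.Lmodule_isLalgebra.Build k principal_quot pquot_scaleAl.
HB.instance Definition _ := GRing.Lalgebra_isComAlgebra.Build k principal_quot.

End PrincipalIdeal.

Section Hermitian.
Variables (k : fieldType) (q r : nat).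

Lemma mpoly_nonunit (n : nat) (p : {mpoly k[n]}) (v w : 'I_n -> k) :
  p.@[v] != p.@[w] -> p \isn't a GRing.unit.
Proof.
by apply: contraNN => /andP[/eqP-> _]; rewrite !mevalC.
Qed.

Definition hermitian : {mpoly k[r.+2]} := \sum_(i < r.+2) 'X_i ^+ q.+1.

(* Restriction to the chart X_0 = 1; the variable of index j in the chart is
   X_{j+1}. *)
Definition dehomogenize (n : nat) (p : {mpoly k[n.+1]}) : {mpoly k[n]} :=
  p \mPo [tuple if unlift ord0 i is Some j then 'X_j else 1 | i < n.+1].

Lemma hermitian_affE :
  dehomogenize hermitian = 1 + \sum_(i < r.+1) 'X_i ^+ q.+1.
Proof.
rewrite /dehomogenize /hermitian rmorph_sum big_ord_recl /=.
rewrite rmorphXn /= comp_mpolyXU -tnth_nth tnth_mktuple unlift_none expr1n.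
congr (_ + _); apply: eq_bigr => i _.
by rewrite rmorphXn /= comp_mpolyXU -tnth_nth tnth_mktuple liftK.
Qed.

Lemma hermitian_aff_nonunit : dehomogenize hermitian \isn't a GRing.unit.
Proof.
apply: (@mpoly_nonunit _ _ (fun=> 0) (fun i => (i == ord0)%:R)).
rewrite hermitian_affE !rmorphD !rmorph_sum /= !rmorph1 eq_sym.
rewrite (inj_eq (addrI _)) (bigD1 ord0) //= rmorphXn /= mevalXU expr1n.
rewrite big1 => [|i /negPf i0]; last by rewrite rmorphXn /= mevalXU i0 expr0n.
rewrite big1 => [|i _]; last by rewrite rmorphXn /= mevalXU expr0n.
by rewrite addr0 oner_neq0.
Qed.

(* The affine coordinate ring of the complement of V(X_0) is presented by the
   dehomogenized equation. *)
Definition hermitian_coord_ring : comAlgType k :=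
  principal_quot hermitian_aff_nonunit.

(* Coordinates of k[X_1, ..., X_{r-1}, X_{r+1}, U]: X_j has index j - 1 for
   1 <= j <= r - 1, X_{r+1} has index r - 1 and U has index r. *)
Definition Xlow (j : nat) : {mpoly k[r.+1]} := 'X_(inord j.-1).
Definition Xlast : {mpoly k[r.+1]} := 'X_(inord r.-1).
Definition Uvar : {mpoly k[r.+1]} := 'X_ord_max.

Definition Fpoly (delta : k) : {mpoly k[r.+1]} :=
  Xlast ^+ q.+1 + (delta ^+ q) *: (Xlow r.-1 ^+ q * Uvar)
  + delta *: (Xlow r.-1 * Uvar ^+ q)
  + \sum_(1 <= j < r.-1) Xlow j ^+ q.+1 - Uvar ^+ q.+1 - 1.

Lemma Fpoly_nonunit (delta : k) :
  (0 < q)%N -> (1 < r)%N -> Fpoly delta \isn't a GRing.unit.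
Proof.
move=> q0 r1.
apply: (@mpoly_nonunit _ _ (fun=> 0) (fun i => (i == inord r.-1)%:R)).
have lowE j : (j < r)%N -> (inord j.-1 == inord r.-1 :> 'I_r.+1) = false.
  move=> jr; apply/negbTE; rewrite -val_eqE /= !inordK; lia.
have maxE : (ord_max == inord r.-1 :> 'I_r.+1) = false.
  by apply/negbTE; rewrite -val_eqE /= !inordK; lia.
have q0E : 0 ^+ q = 0 :> k by rewrite expr0n eqn0Ngt q0.
rewrite /Fpoly /Xlast /Xlow /Uvar.
rewrite !(rmorphB, rmorphD, rmorph_sum, rmorph1) /=.
have sum0 (v : 'I_r.+1 -> k) : (forall j, (j < r)%N -> v (inord j.-1) = 0) ->
    \sum_(1 <= j < r.-1) ('X_(inord j.-1) ^+ q.+1).@[v] = 0.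
  move=> v0; rewrite big_nat big1 // => j /andP[_ jr].
  by rewrite rmorphXn /= mevalXU v0 ?expr0n //; lia.
rewrite !sum0 //; last by move=> j /lowE->.
rewrite !mevalZ !rmorphM !rmorphXn /= !mevalXU eqxx maxE lowE; last by lia.
rewrite expr1n !q0E !expr0n !(mulr0, mul0r, addr0, subr0, add0r) subrr.
by rewrite oppr_eq0 oner_neq0.
Qed.

End Hermitian.

Definition prime_power (q : nat) : Prop :=
  exists p e : nat, [/\ prime p, (0 < e)%N & q = (p ^ e)%N].

Lemma prime_power_gt0 q : prime_power q -> (0 < q)%N.
Proof. by case=> p [e [pr_p _ ->]]; rewrite expn_gt0 prime_gt0. Qed.

Definition presentation_ring (k : fieldType) (q r : nat) (qP : prime_power q)
    (r_ge2 : (2 <= r)%N) (delta : k) : comAlgType k :=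
  principal_quot (Fpoly_nonunit delta (prime_power_gt0 qP) r_ge2).

(* Main.v *)
(* Since [delta^(q+1) = -1], the substitution [X_j -> delta X_j] changes the
   sign of [X_j^(q+1)], and expanding [(U - delta X)^(q+1)] with Frobenius gives
   [U^(q+1) - delta U^q X - delta^q X^q U - X^(q+1)]: substituting
   [U - delta X_(r-1)] for [X_r] and rescaling the other variables turns the
   affine Hermitian equation into [-F = 0].

   On [k[X_1, .., X_(r-1), X_(r+1), U] / F] the order function is the weight of
   the leading part. Exactly two monomials of [F], [T^(q+1)] with
   [T = X_(r+1)] and [X_(r-1)^q U], have the largest weight, and their sum (with
   its coefficients) vanishes at the point [s = (1, .., 1, delta)]. Evaluating at
   [s] the part of given weight of a polynomial is multiplicative on leading
   parts and kills that of [F]; a representative has weight exactly [v] when its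
   monomials have weight at most [v] and its part of weight [v] does not vanish
   at [s]. Remainders of division by [F] in [T] have monomials of distinct
   weights, so every nonzero class has such a representative; multiples of [F]
   never do, so its weight depends only on the class. *)

From HB Require Import structures.
Require Import Defs.
From mathcomp Require Import all_boot all_order all_algebra.
From mathcomp Require Import finfield ring_quotient.
From mathcomp Require Import boolp ssrcomplements mpoly zify ring.

Set Implicit Arguments.
Unset Strict Implicit.
Unset Printing Implicit Defensive.

Import Order.TTheory GRing.Theory Num.Theory.
Local Open Scope ring_scope.
Local Open Scope quotient_scope.

(** * Quotients by a principal ideal *)

Section LinearExtension.
Variables (k : fieldType) (n : nat) (a : 'X_{1..n} -> k).

Definition mlin (p : {mpoly k[n]}) : k := \sum_(m <- msupp p) p@_m * a m.

(** A range of monomials independent of [p] lets the values at several polynomials be added term by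
    term, which gives linearity. *)
Lemma mlinwE N p :
  (msize p <= N)%N -> mlin p = \sum_(m : 'X_{1..n < N}) p@_m * a m.
Proof.
move=> le_pN; rewrite /mlin (big_mksub ('X_{1..n < N} : subFinType _)).
- by rewrite big_rmcond //= => m /memN_msupp_eq0->; rewrite mul0r.
- exact: msupp_uniq.
by move=> m /msize_mdeg_lt/leq_trans; apply.
Qed.

Fact mlin_is_linear : linear_for *%R mlin.
Proof.
move=> c p q; pose N := maxn (msize (c *: p + q)) (maxn (msize p) (msize q)).
rewrite !(@mlinwE N) ?leq_max ?leqnn ?orbT // mulr_sumr -big_split /=.
by apply: eq_bigr => m _; rewrite mcoeffD mcoeffZ mulrDl mulrA.
Qed.

HB.instance Definition _ :=
  GRing.isLinear.Build k {mpoly k[n]} k *%R mlin mlin_is_linear.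

Lemma mlinX m : mlin 'X_[m] = a m.
Proof. by rewrite /mlin msuppX big_seq1 mcoeffX eqxx mul1r. Qed.

End LinearExtension.

(** * Principal quotients and the maps induced between them *)

Section PrincipalQuotient.
Variables (k : comNzRingType) (A : comUnitAlgType k) (f : A).
Variable fNU : f \isn't a GRing.unit.
Local Notation Q := (principal_quot fNU).

Lemma pquot_eqP (x y : A) :
  reflect (exists b, x - y = b * f) (\pi_Q x == \pi_Q y).
Proof. by rewrite -Quotient.idealrBE; apply: asboolP. Qed.

Lemma pquot_piZ c (x : A) : \pi_Q (c *: x) = c *: \pi_Q x.
Proof. by rewrite -pi_scale. Qed.

End PrincipalQuotient.

Section PrincipalQuotientMorphism.
Variables (k : fieldType) (A B : comUnitAlgType k) (f : A) (g : B).
Variables (fNU : f \isn't a GRing.unit) (gNU : g \isn't a GRing.unit).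
Variables (alpha : {lrmorphism A -> B}) (c : k).
Local Notation Qf := (principal_quot fNU).
Local Notation Qg := (principal_quot gNU).

(* The proof argument is what makes the morphism instances below inferable. *)
Definition pquot_map of alpha f = c *: g :=
  fun x : Qf => \pi_Qg (alpha (repr x)).

Hypothesis alphaf : alpha f = c *: g.
Local Notation phi := (pquot_map alphaf).

(** The chosen representative differs from [a] by a multiple of [f], which [alpha] sends to a
    multiple of [g]. *)
Lemma pquot_map_pi a : phi (\pi_Qf a) = \pi_Qg (alpha a).
Proof.
apply/eqP/pquot_eqP; have /eqP/pquot_eqP[b ab] := reprK (\pi_Qf a).
by exists (c *: alpha b); rewrite -rmorphB ab rmorphM /= alphaf -scalerAr scalerAl.
Qed.

Fact pquot_map_linear : linear phi.
Proof.
move=> e; elim/pquotW => x; elim/pquotW => y.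
by rewrite -pquot_piZ -rmorphD !pquot_map_pi linearP rmorphD /= pquot_piZ.
Qed.

Fact pquot_map_monoid : monoid_morphism phi.
Proof.
split; first by rewrite -(rmorph1 \pi_Qf) pquot_map_pi !rmorph1.
elim/pquotW => x; elim/pquotW => y.
by rewrite -rmorphM !pquot_map_pi !rmorphM.
Qed.

HB.instance Definition _ :=
  GRing.isLinear.Build k Qf Qg *:%R phi pquot_map_linear.
HB.instance Definition _ :=
  GRing.isMonoidMorphism.Build Qf Qg phi pquot_map_monoid.

End PrincipalQuotientMorphism.

(** Being inverse to [alpha], [beta] sends [g] to [c^-1 *: f]. Both maps therefore descend, and the
    descended maps are again mutually inverse. *)
Lemma pquot_iso (k : fieldType) (A B : comUnitAlgType k) (f : A) (g : B)
    (fNU : f \isn't a GRing.unit) (gNU : g \isn't a GRing.unit)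
    (alpha : {lrmorphism A -> B}) (beta : {lrmorphism B -> A}) (c : k) :
    c != 0 -> cancel alpha beta -> cancel beta alpha -> alpha f = c *: g ->
  exists phi : {lrmorphism principal_quot fNU -> principal_quot gNU},
    bijective phi.
Proof.
move=> c0 alphaK betaK alphaf.
have betag : beta g = c^-1 *: f.
  by rewrite -[f]alphaK alphaf linearZ scalerA mulVf // scale1r.
exists (@pquot_map _ _ _ _ _ fNU gNU _ _ alphaf).
exists (@pquot_map _ _ _ _ _ gNU fNU _ _ betag) => x /=; rewrite -[x]reprK.
  by rewrite (pquot_map_pi fNU gNU) (pquot_map_pi gNU fNU) alphaK.
by rewrite (pquot_map_pi gNU fNU) (pquot_map_pi fNU gNU) betaK.
Qed.

(** * Weighted leading coefficients *)

(** [le] is only a total preorder, since distinct monomials may tie when compared by weight. *)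
Lemma exists_max (T : eqType) (le : rel T) (l : seq T) :
    total le -> transitive le -> l != [::] ->
  exists2 x, x \in l & {in l, forall y, le y x}.
Proof.
move=> le_tot le_tr; have le_refl x : le x x by have := le_tot x x; rewrite orbb.
elim: l => // a [_ _|b l /(_ isT)[x xl xmax] _].
  by exists a => [|y]; rewrite inE // => /eqP->.
have [le_ax|le_xa] := orP (le_tot a x).
  exists x => [|y]; first by rewrite inE xl orbT.
  by rewrite inE => /predU1P[->|/xmax].
exists a => [|y]; first by rewrite mem_head.
rewrite inE => /predU1P[->|/xmax le_yx]; first exact: le_refl.
exact: le_tr le_yx le_xa.
Qed.

(** * Order arithmetic in a well-ordered semigroup *)

Section WellOrderedSemigroup.
Variables (G : nmodType) (lt : rel G).
Hypothesis wo : well_ordered_semigroup lt.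

Definition wo_le : rel G := fun u v => (u == v) || lt u v.

Lemma wo_le_refl u : wo_le u u.
Proof. by rewrite /wo_le eqxx. Qed.

Lemma wo_ltW u v : lt u v -> wo_le u v.
Proof. by rewrite /wo_le => ->; rewrite orbT. Qed.

Lemma wo_le_lt_trans u v x : wo_le u v -> lt v x -> lt u x.
Proof. by case/predU1P => [->//|]; apply: (wo_trans wo). Qed.

Lemma wo_lt_le_trans u v x : lt u v -> wo_le v x -> lt u x.
Proof. by move=> uv /predU1P[<-//|]; apply: (wo_trans wo). Qed.

Lemma wo_le_trans : transitive wo_le.
Proof.
by move=> v u x uv /predU1P[<-//|vx]; apply: wo_ltW; apply: wo_le_lt_trans vx.
Qed.

Lemma wo_leP u v : wo_le u v \/ lt v u.
Proof.
have [->|neq] := eqVneq u v; first by left; apply: wo_le_refl.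
by have /orP[/wo_ltW|] := wo_total wo neq; [left|right].
Qed.

Lemma wo_lt_nle u v : lt u v -> wo_le v u = false.
Proof.
by move=> uv; apply/negP => /(wo_lt_le_trans uv); rewrite (wo_irr wo).
Qed.

Lemma wo_ltD u v x y : lt u v -> wo_le x y -> lt (u + x) (v + y).
Proof.
move=> uv /predU1P[->|xy]; first exact: (wo_add wo).
apply: (wo_trans wo) (wo_add wo x uv) _.
by rewrite ![v + _]addrC; apply: (wo_add wo).
Qed.

Lemma wo_leD u v x y : wo_le u v -> wo_le x y -> wo_le (u + x) (v + y).
Proof.
move=> /predU1P[->|uv xy]; last by apply: wo_ltW; apply: wo_ltD.
case/predU1P=> [->|xy]; first exact: wo_le_refl.
by rewrite ![v + _]addrC; apply: wo_ltW; apply: (wo_add wo).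
Qed.

(** A strict inequality in either summand would make the sums strictly comparable. Hence the top
    weight of a product comes only from the top weights of its factors. *)
Lemma wo_leD_eq u v x y :
  wo_le u v -> wo_le x y -> u + x = v + y -> u = v /\ x = y.
Proof.
move=> /predU1P[->|uv] xy; last first.
  by move=> e; have := wo_ltD uv xy; rewrite e (wo_irr wo).
case/predU1P: xy => [->//|xy] e; have := wo_add wo v xy.
by rewrite ![_ + v]addrC e (wo_irr wo).
Qed.

End WellOrderedSemigroup.

Section SupportedPolynomials.
Variables (k : fieldType) (n : nat) (P : pred 'X_{1..n}).
Implicit Types (f g : {mpoly k[n]}) (m : 'X_{1..n}).

Definition supp_in f := {in msupp f, forall m, P m}.

Lemma supp_in0 : supp_in 0.
Proof. by move=> m; rewrite msupp0. Qed.

Lemma supp_inX m : P m -> supp_in 'X_[m].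
Proof. by move=> Pm m'; rewrite msuppX inE => /eqP->. Qed.

Lemma supp_inD f g : supp_in f -> supp_in g -> supp_in (f + g).
Proof. by move=> Pf Pg m /msuppD_le; rewrite mem_cat => /orP[/Pf|/Pg]. Qed.

Lemma supp_inZ c f : supp_in f -> supp_in (c *: f).
Proof. by move=> Pf m /msuppZ_le/Pf. Qed.

Lemma supp_inN f : supp_in f -> supp_in (- f).
Proof. by rewrite -scaleN1r; apply: supp_inZ. Qed.

Lemma supp_in_sum (I : eqType) (l : seq I) (a : I -> {mpoly k[n]}) :
  {in l, forall i, supp_in (a i)} -> supp_in (\sum_(i <- l) a i).
Proof.
by move=> al; rewrite big_seq; apply: big_ind => //;
  [exact: supp_in0|exact: supp_inD].
Qed.

End SupportedPolynomials.

Section WeightedLeadingCoefficient.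
Variables (k : fieldType) (n : nat) (G : nmodType) (lt : rel G).
Hypothesis wo : well_ordered_semigroup lt.
Variables (w : 'I_n -> G) (s : 'I_n -> k).
Implicit Types (f g : {mpoly k[n]}) (m : 'X_{1..n}).
Local Notation le := (wo_le lt).

Definition mwt m : G := \sum_i w i *+ m i.

Lemma mwtD m1 m2 : mwt (m1 + m2)%MM = mwt m1 + mwt m2.
Proof.
by rewrite /mwt -big_split /=; apply: eq_bigr => i _; rewrite mnmDE mulrnDr.
Qed.

Lemma mwt0 : mwt 0%MM = 0.
Proof. by rewrite /mwt big1 // => i _; rewrite mnm0E. Qed.

Lemma mwtMn m j : mwt (m *+ j)%MM = mwt m *+ j.
Proof. by elim: j => [|j IHj]; rewrite ?mulm0n ?mwt0 // mulmS mwtD IHj mulrS. Qed.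

Lemma mwt1 i : mwt U_(i)%MM = w i.
Proof.
rewrite /mwt (bigD1 i) //= mnm1E eqxx big1 ?addr0 // => j /negPf ji.
by rewrite mnm1E eq_sym ji.
Qed.

Definition wt_below v := @supp_in k n (fun m => le (mwt m) v).

(* The value at the point [s] of the part of [f] of weight [v]. *)
Definition lead v := mlin (fun m => (mwt m == v)%:R * mmap1 s m).

HB.instance Definition _ v := GRing.Linear.copy (lead v) (mlin _).

Lemma leadX v m : lead v 'X_[m] = (mwt m == v)%:R * mmap1 s m.
Proof. exact: mlinX. Qed.

Definition wt_exact v f := wt_below v f /\ lead v f != 0.

Lemma wt_below_le u v f : wt_below u f -> le u v -> wt_below v f.
Proof. by move=> fu uv m /fu mu; apply: (wo_le_trans wo) uv. Qed.

Lemma lead_below u v f : wt_below u f -> lt u v -> lead v f = 0.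
Proof.
move=> fu uv; rewrite /lead /mlin big_seq big1 // => m /fu mu.
have [mv|] := eqVneq; last by rewrite mul0r mulr0.
by have := wo_le_lt_trans wo mu uv; rewrite mv (wo_irr wo).
Qed.

Lemma wt_belowM u v f g :
  wt_below u f -> wt_below v g -> wt_below (u + v) (f * g).
Proof.
move=> fu gv m /msuppM_le/allpairsP[[m1 m2] /= [/fu m1u /gv m2v ->]].
by rewrite mwtD; apply: wo_leD.
Qed.

(** By [wo_leD_eq], a pair of monomials contributes to weight [u + v] only if their weights are
    exactly [u] and [v]; evaluation at [s] is multiplicative on monomials. *)
Lemma leadM u v f g :
  wt_below u f -> wt_below v g -> lead (u + v) (f * g) = lead u f * lead v g.
Proof.
move=> fu gv; rewrite /lead [X in mlin _ (X * _)]mpolyE [X in mlin _ (_ * X)]mpolyE.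
rewrite mulr_suml linear_sum mulr_suml big_seq [RHS]big_seq /=.
apply: eq_bigr => m1 /fu m1u.
rewrite mulr_sumr linear_sum mulr_sumr big_seq [RHS]big_seq /=.
apply: eq_bigr => m2 /gv m2v.
rewrite -scalerAl -scalerAr -mpolyXD !linearZ /= mlinX mwtD.
have -> : mmap1 s (m1 + m2) = mmap1 s m1 * mmap1 s m2.
  by rewrite /mmap1 -big_split; apply: eq_bigr => i _; rewrite mnmDE exprD.
have -> : (mwt m1 + mwt m2 == u + v) = (mwt m1 == u) && (mwt m2 == v).
  apply/eqP/andP => [/(wo_leD_eq wo m1u m2v)[-> ->] //|[/eqP-> /eqP->]] //.
by rewrite -mulnb natrM; ring.
Qed.

Lemma wt_exactM u v f g :
  wt_exact u f -> wt_exact v g -> wt_exact (u + v) (f * g).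
Proof.
move=> [fu fu0] [gv gv0]; split; first exact: wt_belowM.
by rewrite leadM // mulf_neq0.
Qed.

End WeightedLeadingCoefficient.

(** * Order functions on weighted hypersurfaces *)

(* A monic equation in [X_t] whose part of weight [d * w_t] vanishes at [s]
   defines an order domain, provided that its remainders modulo [F] have
   monomials of distinct weights. *)
Section WeightedHypersurface.
Variables (k : fieldType) (n : nat) (G : nmodType) (lt : rel G).
Hypothesis wo : well_ordered_semigroup lt.
Variables (w : 'I_n -> G) (s : 'I_n -> k).
Variables (t : 'I_n) (d : nat) (F C : {mpoly k[n]}).
Hypothesis s_neq0 : forall i, s i != 0.
Hypothesis d_gt0 : (0 < d)%N.
Hypothesis FE : F = 'X_t ^+ d - C.
Hypothesis C_free : supp_in (fun m => m t == 0%N) C.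
Hypothesis C_below : wt_below lt w (w t *+ d) C.
Hypothesis F_lead : lead w s (w t *+ d) F = 0.
Hypothesis wt_inj : forall m m' : 'X_{1..n},
  (m t < d)%N -> (m' t < d)%N -> mwt w m = mwt w m' -> m = m'.
Hypothesis wt_surj : forall v, exists m, mwt w m = v.
Implicit Types (f g : {mpoly k[n]}) (m : 'X_{1..n}).

Local Notation le := (wo_le lt).
Local Notation below := (wt_below lt w).
Local Notation leadw := (lead w s).
Local Notation exact_wt := (wt_exact lt w s).

Let mmap1_neq0 m : mmap1 s m != 0.
Proof. by apply/prodf_neq0 => i _; rewrite expf_neq0. Qed.

Lemma hypersurface_eq_below : below (w t *+ d) F.
Proof.
rewrite FE mpolyXn; apply/supp_inD/supp_inN/C_below; apply: supp_inX.
by rewrite mwtMn mwt1 wo_le_refl.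
Qed.

(* Among the monomials of [b] of largest weight pick [m0] of largest degree in
   [X_t]: the monomial [m0 * X_t ^ d] of [b * F] does not cancel. *)
Lemma not_wt_exact_mul b v : ~ exact_wt v (b * F).
Proof.
case=> bF_below; have [->|b_neq0] := eqVneq b 0.
  by rewrite mul0r linear0 eqxx.
pose leq_wt m m' :=
  lt (mwt w m) (mwt w m') || (mwt w m == mwt w m') && (m t <= m' t)%N.
have leq_tot : total leq_wt.
  move=> m m'; rewrite /leq_wt.
  have [->|/(wo_total wo)/orP[]->] := eqVneq (mwt w m) (mwt w m').
  - by case/orP: (leq_total (m t) (m' t)) => ->; rewrite !orbT.
  - by [].
  - by rewrite orbT.
have leq_tr : transitive leq_wt.
  move=> m2 m1 m3; rewrite /leq_wt.
  case/orP=> [l12|/andP[/eqP-> t12]]; case/orP=> [l23|/andP[/eqP e23 t23]].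
  - by rewrite (wo_trans wo l12 l23).
  - by rewrite -e23 l12.
  - by rewrite l23.
  - by rewrite e23 eqxx (leq_trans t12 t23) orbT.
have [|m0 m0b m0max] := exists_max leq_tot leq_tr (l := msupp b).
  by rewrite msupp_eq0.
have b_below : below (mwt w m0) b.
  move=> m /m0max/orP[/wo_ltW//|/andP[/eqP-> _]]; exact: wo_le_refl.
have F_below := hypersurface_eq_below.
have m0F : (m0 + U_(t) *+ d)%MM \in msupp (b * F).
  rewrite mcoeff_msupp FE mulrBr mcoeffB mpolyXn.
  rewrite {1}addmC mcoeffMX.
  rewrite [X in _ - X]memN_msupp_eq0 ?subr0 -?mcoeff_msupp //.
  (* A product [m1 * m2] from [b * C] equal to [m0 * X_t ^ d] would force [m1] to have the weight of
     [m0]. As [C] is free of [X_t], its degree in [X_t] would exceed that of [m0] by [d], against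
     the choice of [m0]. *)
  apply/negP => /msuppM_le/allpairsP[[m1 m2] /= [m1b m2C m12]].
  have /= t12 := congr1 (fun m => m t) m12.
  rewrite !mnmDE mulmnE mnm1E eqxx mul1n (eqP (C_free m2C)) addn0 in t12.
  have := congr1 (mwt w) m12; rewrite !mwtD mwtMn mwt1 => e12.
  have [e1 _] := wo_leD_eq wo (b_below _ m1b) (C_below m2C) (esym e12).
  have /orP[|/andP[_]] := m0max _ m1b; first by rewrite e1 (wo_irr wo).
  by rewrite -t12 -[X in (_ <= X)%N]addn0 leq_add2l leqNgt d_gt0.
(* The top weight of [b * F] is thus at most [v]. If it equals [v], the leading value is a multiple
   of that of [F], which is 0; if it is smaller, nothing of weight [v] is left. *)
have := bF_below _ m0F; rewrite mwtD mwtMn mwt1 => /predU1P[<-|lt_v].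
  by rewrite (leadM wo) // F_lead mulr0 eqxx.
by rewrite (lead_below wo s (wt_belowM wo b_below F_below) lt_v) eqxx.
Qed.

(** By [wt_inj] the part of largest weight is a single monomial, which does not vanish at [s]
    because all coordinates of [s] are nonzero. *)
Lemma wt_exact_reduced f :
    supp_in (fun m => m t < d)%N f -> f != 0 ->
  exists v, exact_wt v f.
Proof.
move=> f_red f0; pose leq_wt m m' := le (mwt w m) (mwt w m').
have leq_tot : total leq_wt.
  move=> m m'; rewrite /leq_wt.
  by have [->|/wo_ltW->] := wo_leP wo (mwt w m) (mwt w m'); rewrite ?orbT.
have leq_tr : transitive leq_wt by move=> m2 m1 m3; apply: (wo_le_trans wo).
have [|m0 m0f m0max] := exists_max leq_tot leq_tr (l := msupp f).
  by rewrite msupp_eq0.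
exists (mwt w m0); split=> //; rewrite /lead /mlin.
rewrite (bigD1_seq m0) ?msupp_uniq //= eqxx mul1r big_seq_cond big1 ?addr0.
  by rewrite mulf_neq0 -?mcoeff_msupp.
move=> m /andP[mf m_neq]; case: eqP => [|_]; last by rewrite mul0r mulr0.
by move/wt_inj=> e; case/eqP: m_neq; apply: e; apply: f_red.
Qed.

(** Division with remainder: modulo [F], [X_t ^ d] may be replaced by [C], which is free of [X_t],
    so the degree in [X_t] drops by [d] each time. *)
Lemma hypersurface_reduce f :
  exists b g, f = b * F + g /\ supp_in (fun m => m t < d)%N g.
Proof.
pose red f := exists b g, f = b * F + g /\ supp_in (fun m => m t < d)%N g.
have redD f1 f2 : red f1 -> red f2 -> red (f1 + f2).
  move=> [b1 [g1 [-> g1d]]] [b2 [g2 [-> g2d]]]; exists (b1 + b2), (g1 + g2).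
  by split; [ring|apply: supp_inD].
have redZ c f1 : red f1 -> red (c *: f1).
  move=> [b [g [-> gd]]]; exists (c *: b), (c *: g).
  by rewrite scalerDr scalerAl; split=> //; apply: supp_inZ.
have red_sum (l : seq 'X_{1..n}) (a : 'X_{1..n} -> {mpoly k[n]}) :
    {in l, forall m, red (a m)} -> red (\sum_(m <- l) a m).
  move=> al; rewrite big_seq; apply: (big_ind red) => //.
  by exists 0, 0; split; [rewrite mul0r addr0|exact: supp_in0].
suff redX N m : (m t < N)%N -> red 'X_[m].
  rewrite [f]mpolyE; apply: red_sum => m _.
  exact/redZ/(redX (m t).+1)/ltnSn.
elim: N m => // N IHN m m_t.
have [lt_d|le_d] := ltnP (m t) d.
  by exists 0, 'X_[m]; split; [rewrite mul0r add0r|exact: supp_inX].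
pose m' := (m - U_(t) *+ d)%MM.
have mE : m = (m' + U_(t) *+ d)%MM.
  apply/esym/submK/mnm_lepP => i; rewrite mulmnE mnm1E.
  by case: eqP => [<-|]; rewrite ?mul1n.
have -> : 'X_[m] = 'X_[m'] * F + 'X_[m'] * C.
  by rewrite -mulrDr FE subrK mE mpolyXD mpolyXn.
apply: redD; first by exists 'X_[m'], 0; split; [rewrite addr0|exact: supp_in0].
rewrite [C]mpolyE mulr_sumr; apply: red_sum => m1 m1C.
rewrite -scalerAr -mpolyXD; apply/redZ/IHN.
by rewrite mnmDE mnmBE mulmnE mnm1E eqxx (eqP (C_free m1C)); lia.
Qed.

Variable fNU : F \isn't a GRing.unit.
Local Notation Q := (principal_quot fNU).

Let has_wt (x : Q) v := exists2 f, \pi_Q f = x & exact_wt v f.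

Let has_wt_ex x : x != 0 -> exists v, has_wt x v.
Proof.
elim/pquotW: x => f f_neq0; have [b [g [fE g_red]]] := hypersurface_reduce f.
have pifg : \pi_Q f = \pi_Q g by apply/eqP/pquot_eqP; exists b; rewrite fE addrK.
have [|v gv] := wt_exact_reduced g_red.
  by apply: contra_neq f_neq0; rewrite pifg => ->; rewrite rmorph0.
by exists v; exists g.
Qed.

(** If [u] were below [v], subtracting from [f] a representative of exact weight [v] would give a
    multiple of [F] of exact weight [v]. *)
Let below_wt f u v : below u f -> has_wt (\pi_Q f) v -> le v u.
Proof.
move=> fu [g /esym/eqP/pquot_eqP[b fgE] [gv gv0]].
have [//|lt_uv] := wo_leP wo v u; case: (@not_wt_exact_mul b v); rewrite -fgE.
split; first by apply/supp_inD/supp_inN/gv/(wt_below_le wo fu)/wo_ltW.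
by rewrite linearB /= (lead_below wo s fu lt_uv) sub0r oppr_eq0.
Qed.

(** The same subtraction excludes [v = u] when the leading value of [f] vanishes. This gives the
    strict drop in the cancellation axiom. *)
Let lead0_wt f u v : below u f -> leadw u f = 0 -> has_wt (\pi_Q f) v -> lt v u.
Proof.
move=> fu f0 fv; have /predU1P[vu|//] := below_wt fu fv; rewrite vu in fv.
have [g /esym/eqP/pquot_eqP[b fgE] [gu gu0]] := fv.
case: (@not_wt_exact_mul b u); rewrite -fgE; split; first exact/supp_inD/supp_inN.
by rewrite linearB /= f0 sub0r oppr_eq0.
Qed.

Let has_wt_uniq x u v : has_wt x u -> has_wt x v -> u = v.
Proof.
move=> xu xv; case: (xu) (xv) => f fx [fu _] [g gx [gv _]].
have /predU1P[//|lt_uv] : le u v by apply: (below_wt gv); rewrite gx.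
have : le v u by apply: (below_wt fu); rewrite fx.
by rewrite (wo_lt_nle wo).
Qed.

Let has_wt_neq0 x v : has_wt x v -> x != 0.
Proof.
case=> f <- fv; apply/eqP; rewrite -(rmorph0 \pi_Q) => /eqP/pquot_eqP[b].
by rewrite subr0 => fb; case: (@not_wt_exact_mul b v); rewrite -fb.
Qed.

Lemma hypersurface_order_function :
  exists rho : Q -> option G, order_function lt rho.
Proof.
(* The weight is picked by choice, harmlessly since it is unique; the default [None] is taken
   exactly at 0. *)
pose rho x := if pselect (exists v, has_wt x v) is left e
  then Some (projT1 (cid e)) else None.
have rhoS x v : has_wt x v -> rho x = Some v.
  rewrite /rho => xv; case: pselect => [e|[]]; last by exists v.
  by congr Some; case: cid => u /= xu; apply: has_wt_uniq xu xv.
have rho0 : rho 0 = None.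
  rewrite /rho; case: pselect => // -[v v0].
  by have := has_wt_neq0 v0; rewrite eqxx.
have rhoP x : x = 0 \/ exists2 v, has_wt x v & rho x = Some v.
  have [->|/has_wt_ex[v xv]] := eqVneq x 0; first by left.
  by right; exists v => //; apply: rhoS.
have rho_below f u : below u f -> oo_le lt (rho (\pi_Q f)) (Some u).
  move=> fu; have [->|[v fv ->]] := rhoP (\pi_Q f); first by rewrite rho0.
  by have /predU1P[->|vu] := below_wt fu fv; rewrite /oo_le ?eqxx //= vu orbT.
exists rho; split.
- case=> [v|]; last by exists 0.
  have [m mv] := wt_surj v; exists (\pi_Q 'X_[m]); apply: rhoS; exists 'X_[m] => //.
  split; first by rewrite -mv; apply/supp_inX/wo_le_refl.
  by rewrite leadX mv eqxx mul1r.
- by move=> x; split=> [|->//]; case: (rhoP x) => [//|[v _ ->]].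
- move=> x c c0; have [->|[v [f fx [fv fv0]] ->]] := rhoP x.
    by rewrite scaler0 rho0.
  rewrite -fx -pquot_piZ; apply: rhoS; exists (c *: f) => //.
  split; first exact: supp_inZ.
  by rewrite linearZ mulf_neq0.
- move=> x y; have [->|[u [f fx [fu _]] rx]] := rhoP x.
    rewrite add0r rho0; have [->|[v _ ->]] := rhoP y; first by rewrite rho0.
    by rewrite /oo_le /= eqxx.
  have [->|[v [g gy [gv _]] ry]] := rhoP y.
    by rewrite addr0 rho0 rx /oo_le /= eqxx.
  rewrite rx ry -fx -gy -rmorphD /oo_max /=.
  case: ifP => uv; apply: rho_below; apply: supp_inD => //.
    by apply: (wt_below_le wo) fu (wo_ltW uv).
  apply: (wt_below_le wo) gv _; have [//|lt_uv] := wo_leP wo v u.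
  by rewrite lt_uv in uv.
- move=> x y; have [->|[u [f fx [fu fu0]] rx]] := rhoP x; first by rewrite rho0.
  have [->|[v [g gy [gv gv0]] ry]] := rhoP y; first by rewrite rho0 rx.
  rewrite rx ry => -[uv] _; rewrite -{v}uv in gv gv0 ry *.
  (* This ratio makes the leading value of [f - c *: g] vanish at weight [u]. *)
  pose c := leadw u f / leadw u g; exists c; first by rewrite mulf_neq0 ?invr_neq0.
  rewrite -fx -gy -pquot_piZ -rmorphB /=.
  have [->|[v fgv ->]] := rhoP (\pi_Q (f - c *: g)); first by rewrite rho0.
  apply: lead0_wt fgv; first exact/supp_inD/supp_inN/supp_inZ.
  by rewrite linearB linearZ /= divfK ?subrr.
- move=> x y; have [->|[u [f fx fu] rx]] := rhoP x; first by rewrite mul0r rho0.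
  have [->|[v [g gy gv] ry]] := rhoP y; first by rewrite mulr0 rho0 rx.
  rewrite rx ry; apply: rhoS; exists (f * g); first by rewrite -fx -gy rmorphM.
  exact: wt_exactM.
Qed.

End WeightedHypersurface.

(** * The value semigroup *)

Section LexicographicOrder.
Variable r : nat.
Implicit Types a b c : 'rV[int]_r.

Lemma lex_ltP a b :
  reflect (exists i : 'I_r, (forall j : 'I_r, (j < i)%N -> a 0 j = b 0 j) /\
                            (a 0 i < b 0 i)%R)
          (lex_lt a b).
Proof.
apply: (iffP existsP) => -[i].
  by case/andP=> /forallP ab lt_i; exists i; split=> // j /(implyP (ab j))/eqP.
case=> ab lt_i; exists i; rewrite lt_i andbT.
by apply/forallP=> j; apply/implyP=> /ab->.
Qed.

Lemma lex_lt_irr : irreflexive (@lex_lt r).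
Proof. by move=> a; apply/lex_ltP => -[i [_]]; rewrite ltxx. Qed.

Lemma lex_lt_trans : transitive (@lex_lt r).
Proof.
move=> b a c /lex_ltP[i [ab lt_ab]] /lex_ltP[j [bc lt_bc]]; apply/lex_ltP.
have [lt_ij|lt_ji|/val_inj eij] := ltngtP i j.
- exists i; split=> [l li|]; last by rewrite -bc.
  by rewrite ab // bc // (ltn_trans li).
- exists j; split=> [l lj|]; last by rewrite ab.
  by rewrite ab ?bc // (ltn_trans lj).
- exists i; rewrite -eij in bc lt_bc; split=> [l li|]; first by rewrite ab ?bc.
  exact: lt_trans lt_ab lt_bc.
Qed.

Lemma lex_lt_total a b : a != b -> lex_lt a b || lex_lt b a.
Proof.
move=> neq_ab; have [i0 i0P] : exists i, a 0 i != b 0 i.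
  apply/existsP; apply: contraR neq_ab; rewrite negb_exists => /forallP eq_ab.
  by apply/eqP/rowP => i; apply/eqP; have := eq_ab i; rewrite negbK.
case: (@arg_minnP _ i0 (fun i => a 0 i != b 0 i) val i0P) => i neq_i min_i.
have eq_ab (j : 'I_r) : (j < i)%N -> a 0 j = b 0 j.
  by move=> lt_ji; apply/eqP; apply: contraLR lt_ji => /min_i; rewrite -leqNgt.
have /orP[lt_i|lt_i] := lt_total neq_i; apply/orP; [left|right];
  by apply/lex_ltP; exists i; split=> // j /eq_ab.
Qed.

Lemma lex_lt_add a b c : lex_lt a b -> lex_lt (a + c) (b + c).
Proof.
case/lex_ltP=> i [ab lt_i]; apply/lex_ltP; exists i; rewrite !mxE ltrD2r.
by split=> // j /ab; rewrite !mxE => ->.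
Qed.

End LexicographicOrder.

(** A descending chain never increases [deg], and within one degree it takes pairwise distinct
    values of [e] in a finite list. *)
Lemma wf_finite_fibers (T : Type) (E : eqType) (e : T -> E)
    (lt : T -> T -> Prop) (deg : T -> nat) :
    (forall x y z, lt x y -> lt y z -> lt x z) ->
    (forall x y, lt x y -> e x <> e y) ->
    (forall x y, lt x y -> (deg x <= deg y)%N) ->
    (forall d, exists l : seq E, forall x, deg x = d -> e x \in l) ->
  well_founded lt.
Proof.
move=> lt_tr lt_irr lt_deg fin_deg.
suff acc d x : (deg x < d)%N -> Acc lt x by move=> x; apply: (acc (deg x).+1).
(* [done] loops on [Acc]. *)
elim: d x => [x|d IHd x]; first by rewrite ltn0.
rewrite ltnS leq_eqVlt => /predU1P[xd|/IHd]; last exact.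
have [l0 l0P] := fin_deg d.
have {l0P} : forall y, lt y x -> deg y = d -> e y \in l0 by move=> y _ /l0P.
(* Inner induction, on the size of a list containing the values of [e] at the elements of degree [d]
   below [x]. *)
move: {2}(size l0).+1 (ltnSn (size l0)) => N.
elim: N l0 x xd => [l x _|N IHN l x xd l_N xl]; first by rewrite ltn0.
constructor=> y yx.
have := lt_deg _ _ yx; rewrite xd leq_eqVlt => /predU1P[yd|/IHd]; last exact.
(* Below [y] the value [e y] cannot recur, so it is removed from the list, which becomes strictly
   shorter. *)
apply: (IHN [seq z <- l | z != e y] y yd) => [|z zy zd].
  apply: (@leq_trans (size l)) => //; rewrite size_filter.
  rewrite -(count_predC (predC1 (e y)) l) -[X in (X < _)%N]addn0 ltn_add2l.
  by rewrite -has_count; apply/hasP; exists (e y); [exact: xl|rewrite /= negbK].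
rewrite mem_filter xl ?andbT //; last exact: lt_tr zy yx.
by apply/eqP/lt_irr.
Qed.

(** * Generators of the value semigroup and its well-ordering *)

Section ValueSemigroup.
Variables (q r : nat).
Hypothesis r_ge2 : (2 <= r)%N.
Local Notation Gamma := (value_semigroup q r).

Lemma size_value_gens : size (value_gens q r) = r.+1.
Proof. by rewrite /= size_rcons size_map size_iota; lia. Qed.

Lemma nth_value_gens i : (i <= r)%N -> (value_gens q r)`_i =
  stdb r 1 - (if i == 0%N then 0 else if i == r then stdb r r *+ q.+1
              else stdb r i.+1).
Proof.
case: i => [|i] /= i_r; first by rewrite subr0.
rewrite nth_rcons size_map size_iota.
case: ltngtP => [lt_i|gt_i|eq_i]; first last.
- by rewrite eq_i prednK ?eqxx //; lia.
- lia.
rewrite (nth_map 0%N) ?size_iota // nth_iota // add2n.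
by case: eqP => //; lia.
Qed.

Lemma stdbE i (j : 'I_r) : stdb r i 0 j = (j.+1 == i)%:R.
Proof. by rewrite mxE. Qed.

(** Only multiples of e_2, .., e_r are subtracted from e_1. The first coordinate of a combination
    therefore counts the generators in it. *)
Lemma value_gens0 (i0 : 'I_r) i :
  val i0 = 0%N -> (i <= r)%N -> (value_gens q r)`_i 0 i0 = 1.
Proof.
move=> i00 ir; rewrite nth_value_gens // !mxE i00 eqxx.
case: eqP => [|/eqP i_gt0]; first by rewrite mxE subr0.
case: eqP => _; last by rewrite stdbE i00 eqSS eq_sym (negPf i_gt0) subr0.
by rewrite mulmxnE stdbE i00; case: eqP; rewrite ?mul0rn ?subr0 //; lia.
Qed.

Lemma gsvalP (a : Gamma) : exists c : 'I_(size (value_gens q r)) -> nat,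
  gsval a = \sum_(i < size (value_gens q r)) (value_gens q r)`_i *+ c i.
Proof. by case: a => a /= /asboolP. Qed.

(** All of Z^r is not well-ordered lexicographically, but on the semigroup the first coordinate is a
    natural number that dominates the order and has finite fibres. *)
Lemma value_lt_wo : well_ordered_semigroup (@value_lt q r).
Proof.
have i0P : (0 < r)%N by apply: ltnW.
pose i0 := Ordinal i0P.
have coord0 (c : 'I_(size (value_gens q r)) -> nat) :
    (\sum_(i < size (value_gens q r)) (value_gens q r)`_i *+ c i) 0 i0 = (\sum_i c i)%:R.
  rewrite summxE natr_sum; apply: eq_bigr => i _.
  by rewrite mulmxnE value_gens0 // -ltnS -size_value_gens.
pose deg (a : Gamma) := `|gsval a 0%R i0|%N.
have degE (a : Gamma) : gsval a 0 i0 = deg a.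
  by rewrite /deg; have [c ->] := gsvalP a; rewrite coord0 natz.
split.
- by move=> a; apply: lex_lt_irr.
- by move=> b a c; apply: lex_lt_trans.
- by move=> a b neq_ab; apply: lex_lt_total.
- apply: (@wf_finite_fibers _ _ (@gsval _ _) _ deg) => /=.
  + by move=> x y z; apply: lex_lt_trans.
  + by move=> x y + xy; rewrite /value_lt xy lex_lt_irr.
  + move=> x y /lex_ltP[i [eq_i lt_i]]; rewrite -lez_nat -!degE.
    have [i_gt0|] := ltnP 0 i; first by rewrite eq_i.
    by rewrite leqn0 => /eqP/(@val_inj _ _ _ i i0)<-; apply: ltW.
  (* The coefficients of a combination of degree [d] sum to [d], so each is at most [d] and finitely
     many tuples suffice. *)
  move=> d; exists [seq \sum_(i < size (value_gens q r)) (value_gens q r)`_i *+ c i |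
    c : {ffun 'I_(size (value_gens q r)) -> 'I_d.+1}].
  move=> x; have [c xc] := gsvalP x; rewrite /deg xc coord0 natz absz_nat => cd.
  apply/imageP; exists [ffun i => inord (c i)] => //.
  apply: eq_bigr => i _; rewrite ffunE inordK // ltnS -cd.
  by rewrite (bigD1 i) //= leq_addr.
- by move=> a b c; apply: lex_lt_add.
Qed.

End ValueSemigroup.

Lemma nth_generated (M : zmodType) (s : seq M) i : s`_i \in generated s.
Proof.
have [i_s|i_s] := ltnP i (size s); last first.
  by rewrite nth_default //; case: (generated_nmod_closed s).
apply/asboolP; exists (fun j => (j == Ordinal i_s) : nat).
rewrite (bigD1 (Ordinal i_s)) //= eqxx mulr1n big1 ?addr0 // => j /negPf->.
exact: mulr0n.
Qed.

Lemma eq_inord n i j : (i <= n)%N -> (j <= n)%N ->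
  (inord i == inord j :> 'I_n.+1) = (i == j).
Proof. by move=> i_n j_n; rewrite -val_eqE /= !inordK. Qed.

Lemma ord_max_inord n : ord_max = inord n :> 'I_n.+1.
Proof. by apply/val_inj; rewrite /= inordK. Qed.

(** * Weights of the variables and of the monomials of the equation *)

Section Weights.
Variables (q r : nat).
Hypotheses (q_ge2 : (2 <= q)%N) (r_ge2 : (2 <= r)%N).
Local Notation Gamma := (value_semigroup q r).

Definition value_gen i : Gamma := GeneratedSemigroup (nth_generated _ i).

(* With the numbering of the coordinates used for [Fpoly], [X_(r-1)] has weight
   e_1, [X_j] has weight e_1 - e_(j+1) for j < r - 1, [X_(r+1)] has weight
   e_1 - e_r and [U] has weight e_1 - (q+1) e_r. *)
Definition var_gen (i : nat) : nat :=
  if (i.+2 < r)%N then i.+1 else if i.+2 == r then 0%N else i.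

Definition var_wt (i : 'I_r.+1) : Gamma := value_gen (var_gen i).

Local Notation wt := (mwt var_wt).
Local Notation coord m j := ((gsval (wt m) : 'rV[int]_r) 0 j).

(** The branches are, in order, the variables [X_j] with j < r - 1, [X_(r+1)], [U] and [X_(r-1)]. *)
Lemma var_wtE (i : 'I_r.+1) (j : 'I_r) :
  (gsval (var_wt i) : 'rV[int]_r) 0 j = (j == 0%N :> nat)%:R -
    (if (i.+2 < r)%N then (j == i.+1 :> nat)%:R else
     if i.+1 == r then (j.+1 == r)%:R else
     if i == r :> nat then (j.+1 == r)%:R *+ q.+1 else 0).
Proof.
have ir := ltn_ord i; have -> : gsval (var_wt i) = (value_gens q r)`_(var_gen i) by [].
rewrite (nth_value_gens q r_ge2) /var_gen; last first.
  by case: ifP => ?; [|case: ifP => ?]; lia.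
rewrite !mxE eqSS; congr (_ - _).
have [lt_i|le_r] := ltnP i.+2 r.
  by rewrite /= (ltn_eqF (ltnW lt_i)) stdbE eqSS.
have [e|ne] := eqVneq i.+2 r.
  by rewrite eqxx mxE; do 2![case: eqP => [?|_]; first lia].
have [i0|i_gt0] := eqVneq (i : nat) 0%N; first lia.
have [e|ne'] := eqVneq (i : nat) r; last first.
  by have e : i.+1 = r by [lia]; rewrite stdbE e eqxx.
by rewrite e mulmxnE stdbE (gtn_eqF (ltnSn r)).
Qed.

Lemma coordE m j :
  coord m j = \sum_i (gsval (var_wt i) : 'rV[int]_r) 0 j *+ m i.
Proof.
have -> : gsval (wt m) = \sum_i gsval (var_wt i) *+ m i.
  rewrite [LHS](raddf_sum (\val : Gamma -> _)); apply: eq_bigr => i _.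
  exact: (raddfMn (\val : Gamma -> _)).
by rewrite summxE; apply: eq_bigr => i _; rewrite mulmxnE.
Qed.

Lemma coord_first m (j : 'I_r) : j = 0%N :> nat -> coord m j = (mdeg m)%:R.
Proof.
move=> j0; rewrite coordE mdegE natr_sum; apply: eq_bigr => i _.
rewrite var_wtE j0 eqxx (ltn_eqF r_ge2) /= mul0rn.
by rewrite !if_same subr0.
Qed.

Lemma coord_mid m (j : 'I_r) : (0 < j)%N -> (j.+1 < r)%N ->
  coord m j = - (m (inord j.-1))%:R.
Proof.
move=> j_gt0 j_r; have j1 : (inord j.-1 : 'I_r.+1) = j.-1 :> nat.
  by rewrite inordK //; lia.
rewrite coordE (bigD1 (inord j.-1)) // big1 => [|i neq]; last first.
  rewrite var_wtE (gtn_eqF j_gt0) (ltn_eqF j_r) mul0rn /=.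
  have -> : (j == i.+1 :> nat) = false.
    by apply: contraNF neq => /eqP ji; apply/eqP/ord_inj; rewrite j1 ji.
  by rewrite mulr0n !if_same subrr mul0rn.
rewrite var_wtE (gtn_eqF j_gt0) j1 prednK // eqxx j_r /= addr0 sub0r.
by rewrite mulNrn.
Qed.

Lemma coord_last m (j : 'I_r) : j.+1 = r ->
  coord m j = - (m (inord r.-1) + q.+1 * m ord_max)%N%:R.
Proof.
move=> j_r; have t1 : (inord r.-1 : 'I_r.+1) = r.-1 :> nat.
  by rewrite inordK //; lia.
have j_neq0 : (j == 0%N :> nat) = false by apply/eqP; lia.
have neq_t : inord r.-1 != ord_max :> 'I_r.+1.
  by apply/eqP => /(congr1 val) /=; rewrite t1; lia.
rewrite coordE (bigD1 ord_max) // (bigD1 (inord r.-1)) // big1 => [|i]; last first.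
  case/andP=> neq_max neq_i; rewrite var_wtE j_neq0.
  have /negPf-> : (i : nat) != r.
    by apply: contra neq_max => /eqP ir; apply/eqP/ord_inj.
  have /negPf-> : i.+1 != r.
    by apply: contra neq_i => /eqP ir; apply/eqP/ord_inj; rewrite t1; lia.
  by case: ifP => [lt_i|_]; rewrite ?subrr ?mul0rn // gtn_eqF ?subrr ?mul0rn //; lia.
rewrite !var_wtE j_neq0 t1 /= addr0 prednK ?j_r ?eqxx; last lia.
rewrite (gtn_eqF (ltnSn r)) !ltnNge (leqnSn r) (ltnW (leqnSn r.+1)) /=.
by rewrite !sub0r !mulNrn -opprD addrC mulrnDr mulrnA.
Qed.

Lemma ord_cases (j : 'I_r) :
  [\/ j = 0%N :> nat, (0 < j)%N /\ (j.+1 < r)%N | j.+1 = r].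
Proof.
have jr := ltn_ord j; have [j0|j_gt0] := posnP j; first exact: Or31.
by have [jr1|jr1] := ltnP j.+1 r; [apply: Or32|apply: Or33; lia].
Qed.

Local Notation T := (inord r.-1 : 'I_r.+1).

(** The middle coordinates give the exponents of [X_j] for j < r - 1. The last one gives those of
    [X_(r+1)] and [U] as remainder and quotient modulo [q.+1]. The first one is the total degree,
    which leaves the exponent of [X_(r-1)]. *)
Lemma wt_inj_reduced (m m' : 'X_{1..r.+1}) :
  (m T < q.+1)%N -> (m' T < q.+1)%N -> wt m = wt m' -> m = m'.
Proof.
move=> m_red m'_red eq_wt.
have eq_coord (j : 'I_r) : coord m j = coord m' j by rewrite eq_wt.
have eq_low i : (i.+2 < r)%N -> m (inord i) = m' (inord i).
  move=> i_r; have /eqP := eq_coord (Ordinal (ltnW i_r)).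
  by rewrite !coord_mid //= eqr_opp eqr_nat => /eqP.
have [eq_T eq_max] : m T = m' T /\ m ord_max = m' ord_max.
  have r1 : (r.-1 < r)%N by lia.
  have /eqP := eq_coord (Ordinal r1).
  rewrite !coord_last /= ?eqr_opp ?eqr_nat; try lia.
  move=> /eqP e; have := congr1 (fun a => a %% q.+1)%N e.
  have := congr1 (fun a => a %/ q.+1)%N e.
  rewrite /= ![(q.+1 * _)%N]mulnC !(addnC (_ T)) !divnMDl // !modnMDl.
  by rewrite !divn_small // !addn0 !modn_small.
have eq_neq i : i != inord r.-2 -> m i = m' i.
  move=> neq; rewrite -[i]inord_val in neq *; have ir := ltn_ord i.
  rewrite eq_inord in neq; try lia.
  have [/eq_low//|le_i] := ltnP i.+2 r.
  have [->//|neq1] := eqVneq (i : nat) r.-1.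
  by rewrite (_ : (i : nat) = r) -?ord_max_inord //; lia.
apply/mnmP => i; have [->|/eq_neq//] := eqVneq i (inord r.-2).
have /eqP := eq_coord (Ordinal (ltnW r_ge2)).
rewrite !coord_first // eqr_nat !mdegE (bigD1 (inord r.-2)) //=.
rewrite [X in _ == X](bigD1 (inord r.-2)) //= (eq_bigr m') ?eqn_add2r.
  by move/eqP.
exact: eq_neq.
Qed.

Lemma wt_surj v : exists m, wt m = v.
Proof.
(* [idx] inverts [var_gen]: it gives the variable whose weight is the generator number [i]. *)
pose idx (i : nat) : 'I_r.+1 := inord
  (if i == 0%N then r.-2 else if (i.+1 < r)%N then i.-1 else i).
have idxK i : (i <= r)%N -> var_gen (idx i) = i.
  move=> ir; rewrite /var_gen /idx inordK; last first.
    by case: eqP => ?; [|case: ifP => ?]; lia.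
  have [->|i_neq0] := eqVneq i 0%N; first by case: ifP => ?; [|case: ifP => ?]; lia.
  by case: (ltnP i.+1 r) => ?; (case: ifP => ?; [|case: ifP => ?]; lia).
have [c vc] := gsvalP v; exists (\sum_(i < size (value_gens q r)) U_(idx i) *+ c i)%MM.
rewrite (big_morph wt (mwtD var_wt) (mwt0 var_wt)).
apply: val_inj; rewrite /= vc [LHS](raddf_sum (\val : Gamma -> _)).
apply: eq_bigr => i _; rewrite mwtMn mwt1.
rewrite (raddfMn (\val : Gamma -> _)) /= idxK //.
by rewrite -ltnS -(size_value_gens q r_ge2).
Qed.

Let top := wt (U_(T) *+ q.+1)%MM.

Lemma coord_mid_top (j : 'I_r) : (0 < j)%N -> (j.+1 < r)%N ->
  (gsval top : 'rV[int]_r) 0 j = 0.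
Proof.
move=> j_gt0 j_r; rewrite coord_mid // mulmnE mnm1E eq_inord; lia.
Qed.

Lemma coord_last_top (j : 'I_r) : j.+1 = r ->
  (gsval top : 'rV[int]_r) 0 j = - q.+1%:R.
Proof.
move=> j_r; rewrite coord_last // !mulmnE !mnm1E eqxx ord_max_inord.
by rewrite eq_inord ?ltn_eqF ?mul0n ?muln0 ?mul1n ?addn0 //; lia.
Qed.

(** Both sides are (q+1)(e_1 - e_r), since q e_1 + (e_1 - (q+1) e_r) has this value. This tie makes
    [X_(r-1)^q U] a second leading monomial. *)
Lemma wt_top : wt (U_(inord r.-2) *+ q + U_(ord_max))%MM = top.
Proof.
apply/val_inj/rowP => j; rewrite /= ord_max_inord.
have [j0|[j_gt0 j_r]|j_r] := ord_cases j.
- by rewrite !coord_first // mdegD !mdegMn !mdeg1 !mul1n addn1.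
- rewrite coord_mid_top // coord_mid // mnmDE mulmnE !mnm1E !eq_inord; lia.
- rewrite coord_last_top // coord_last // ord_max_inord !mnmDE !mulmnE !mnm1E.
  by rewrite !eq_inord ?eqxx; lia.
Qed.

(** The first difference is at e_(i+2), where the entries are -(q+1) and 0. *)
Lemma lt_top_low i : (i.+2 < r)%N ->
  value_lt (wt (U_(inord i) *+ q.+1)%MM) top.
Proof.
move=> i_r; apply/lex_ltP; exists (Ordinal (ltnW i_r)); split=> [j ji|].
  have [j0|[j_gt0 j_r]|j_r] := ord_cases j.
  - by rewrite !coord_first // !mdegMn !mdeg1.
  - rewrite coord_mid_top // coord_mid // mulmnE mnm1E eq_inord; move: ji => /=; lia.
  - by move: ji => /=; lia.
by rewrite coord_mid_top // coord_mid //= mulmnE mnm1E eqxx oppr_lt0 ltr0n.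
Qed.

(** The weights agree up to the last coordinate, which is at most -2(q+1) for [m] and is -(q+1) for
    [top]. This covers [X_(r-1) U^q], as q >= 2, and [U^(q+1)]. *)
Lemma lt_top_last m : mdeg m = q.+1 ->
    (forall i, (i.+2 < r)%N -> m (inord i) = 0%N) -> (1 < m ord_max)%N ->
  value_lt (wt m) top.
Proof.
move=> deg_m m_low m_max; have r1 : (r.-1 < r)%N by lia.
apply/lex_ltP; exists (Ordinal r1); split=> [j /= jr|].
  have [j0|[j_gt0 j_r]|j_r] := ord_cases j; last lia.
  - by rewrite !coord_first // deg_m mdegMn mdeg1 mul1n.
  - by rewrite coord_mid_top // coord_mid // m_low ?oppr0 //; lia.
rewrite coord_last_top ?coord_last ?prednK //=; try lia.
by rewrite ltrN2 ltr_nat; nia.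
Qed.

Lemma lt_top_0 : value_lt 0 top.
Proof.
rewrite -(mwt0 var_wt); apply/lex_ltP.
exists (Ordinal (ltnW r_ge2)); split=> [//|].
by rewrite !coord_first // mdeg0 mdegMn mdeg1 ltr_nat.
Qed.

End Weights.

(** * The presentation and its order function *)

Lemma root_of_neg1_neq0 (k : fieldType) n (x : k) : x ^+ n.+1 = -1 -> x != 0.
Proof.
by apply: contra_eq_neq => ->; rewrite expr0n eq_sym oppr_eq0 oner_neq0.
Qed.

Section PresentationOrderFunction.
Variables (k : fieldType) (q r : nat) (delta : k).
Hypotheses (q_ge2 : (2 <= q)%N) (r_ge2 : (2 <= r)%N).
Hypothesis deltaE : delta ^+ q.+1 = -1.
Local Notation T := (inord r.-1 : 'I_r.+1).
Local Notation X := (inord r.-2 : 'I_r.+1).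
Local Notation w := (@var_wt q r).
Local Notation wt := (mwt w).
Local Notation F := (Fpoly q r delta).

(** Written in explicit monomials, so that support and weights can be read off term by term. *)
Let C : {mpoly k[r.+1]} := - (delta ^+ q *: 'X_[U_(X) *+ q + U_(ord_max)]
  + delta *: 'X_[U_(X) + U_(ord_max) *+ q]
  + \sum_(1 <= j < r.-1) 'X_[U_(inord j.-1) *+ q.+1]
  - 'X_[U_(ord_max) *+ q.+1] - 'X_[0]).

Let FE : F = 'X_T ^+ q.+1 - C.
Proof.
rewrite /C /Fpoly /Xlast /Xlow /Uvar mpolyX0 !mpolyXD -!mpolyXn.
under [in RHS]eq_bigr do rewrite -mpolyXn.
by rewrite opprK !addrA.
Qed.

Let wt_T : w T *+ q.+1 = wt (U_(T) *+ q.+1).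
Proof. by rewrite mwtMn mwt1. Qed.

Let lt_top_XU : value_lt (wt (U_(X) + U_(ord_max) *+ q)) (wt (U_(T) *+ q.+1)).
Proof.
apply: lt_top_last => //.
- by rewrite mdegD mdegMn !mdeg1 mul1n.
- move=> i i_r; rewrite mnmDE mulmnE !mnm1E ord_max_inord !eq_inord; lia.
- by rewrite mnmDE mulmnE !mnm1E eqxx ord_max_inord !eq_inord; lia.
Qed.

Let lt_top_U : value_lt (wt (U_(ord_max) *+ q.+1)) (wt (U_(T) *+ q.+1)).
Proof.
apply: lt_top_last => //.
- by rewrite mdegMn mdeg1 mul1n.
- move=> i i_r; rewrite mulmnE !mnm1E ord_max_inord !eq_inord; lia.
- by rewrite mulmnE !mnm1E eqxx; lia.
Qed.

Let lt_top_wt0 : value_lt (wt 0%MM) (wt (U_(T) *+ q.+1)).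
Proof. by rewrite mwt0; apply: lt_top_0. Qed.

Let C_supp : supp_in
  (fun m => (m T == 0%N) && wo_le (@value_lt q r) (wt m) (wt (U_(T) *+ q.+1))) C.
Proof.
do ?[apply: supp_inN|apply: supp_inD|apply: supp_inZ|apply: supp_inX].
- rewrite wt_top // wo_le_refl andbT.
  by rewrite mnmDE mulmnE !mnm1E ord_max_inord !eq_inord; lia.
- rewrite wo_ltW // andbT.
  by rewrite mnmDE mulmnE !mnm1E ord_max_inord !eq_inord; lia.
- apply: supp_in_sum => j; rewrite mem_index_iota => /andP[j_gt0 j_r].
  apply: supp_inX; rewrite wo_ltW ?andbT; last by apply: lt_top_low; lia.
  by rewrite mulmnE mnm1E eq_inord; lia.
- rewrite wo_ltW // andbT.
  by rewrite mulmnE !mnm1E ord_max_inord !eq_inord; lia.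
- by rewrite mnm0E wo_ltW.
Qed.

Let s (i : 'I_r.+1) : k := if i == ord_max then delta else 1.

(** Only [X_(r+1)^(q+1)] and [delta^q X_(r-1)^q U] have the top weight; at [s] they take the values
    1 and [delta^(q+1) = -1]. *)
Let F_lead : lead w s (w T *+ q.+1) F = 0.
Proof.
have wo := @value_lt_wo q r r_ge2.
have lead_lt m : value_lt (wt m) (wt (U_(T) *+ q.+1)) ->
    lead w s (wt (U_(T) *+ q.+1)) 'X_[m] = 0.
  by apply: (lead_below wo); apply/supp_inX/wo_le_refl.
have neq_max i : (i < r)%N -> inord i != ord_max :> 'I_r.+1.
  by move=> i_r; rewrite ord_max_inord eq_inord; lia.
rewrite FE /C opprK wt_T mpolyXn !(linearD, linearN) /=.
rewrite !linearZ /= linear_sum /=.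
rewrite (lead_lt _ lt_top_XU) (lead_lt _ lt_top_U) (lead_lt _ lt_top_wt0).
rewrite big_nat big1 => [|j /andP[j_gt0 j_r]]; last first.
  by apply/lead_lt/lt_top_low; lia.
rewrite !leadX wt_top // eqxx !mul1r !mulr0 !oppr0 !addr0.
have mmap1E m : mmap1 s m = 'X_[m].@[s] by rewrite mevalX.
rewrite !mmap1E mpolyXD -!mpolyXn rmorphM /= !rmorphXn /= !mevalXU /s eqxx.
rewrite !(negPf (neq_max _ _)); try lia.
by rewrite !expr1n mul1r -exprSr deltaE subrr.
Qed.

Lemma Fpoly_order_function (fNU : F \isn't a GRing.unit) :
  exists rho : principal_quot fNU -> option (value_semigroup q r),
    order_function (@value_lt q r) rho.
Proof.
have wo := @value_lt_wo q r r_ge2.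
apply: (@hypersurface_order_function _ _ _ _ wo w s T q.+1 F C) => //.
- move=> i; rewrite /s; case: ifP => _; last exact: oner_neq0.
  exact: root_of_neg1_neq0 deltaE.
- by move=> m /C_supp/andP[].
- by move=> m /C_supp/andP[]; rewrite wt_T.
- exact: wt_inj_reduced.
- exact: wt_surj.
Qed.

End PresentationOrderFunction.

Lemma order_function_comp (k : fieldType) (R S : comAlgType k)
    (G : nmodType) (lt : rel G) (rho : S -> option G)
    (phi : {lrmorphism R -> S}) :
  bijective phi -> order_function lt rho -> order_function lt (rho \o phi).
Proof.
move=> phi_bij [surj ninfty scale add cancel mul].
split=> /= [v|f|f c|f g|f g|f g].
- by have [f <-] := surj v; have [psi _ psiK] := phi_bij; exists (psi f); rewrite /= psiK.
- split=> [/ninfty f0|->]; last by apply/ninfty; rewrite rmorph0.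
  by apply: (bij_inj phi_bij); rewrite f0 rmorph0.
- by rewrite linearZ; apply: scale.
- by rewrite rmorphD; apply: add.
- by move=> fg f0; have [c c0] := cancel _ _ fg f0; exists c; rewrite // linearB linearZ.
- by rewrite rmorphM mul.
Qed.

(** * Change of coordinates *)

(** Reduces the cancellation identities for the coordinate change to a check on variables. *)
Lemma mpoly_lrmorphism_id (k : fieldType) n
    (f : {lrmorphism {mpoly k[n]} -> {mpoly k[n]}}) :
  (forall i, f 'X_i = 'X_i) -> f =1 id.
Proof.
move=> fX p; rewrite /= [in RHS](mpolyE p) [in LHS](mpolyE p) linear_sum /=.
apply: eq_bigr => m _; rewrite linearZ /=; congr (_ *: _).
rewrite mpolyXE_id rmorph_prod; apply: eq_bigr => i _.
by rewrite rmorphXn /= fX.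
Qed.

Section ChangeOfCoordinates.
Variables (k : fieldType) (q r : nat) (delta : k).
Hypothesis deltaE : delta ^+ q.+1 = -1.
Hypothesis qchar : [pchar k].-nat q.
Local Notation P := {mpoly k[r.+3]}.
Local Notation Y i := ('X_(inord i) : P).

Let delta0 : delta != 0 := root_of_neg1_neq0 deltaE.

(** Here [r.+2] stands for the r of the theorem. On the source side the indices [r], [r.+1], [r.+2]
    are [X_(r-1)], [X_r], [X_(r+1)] in the theorem's numbering; on the target side they are
    [X_(r-1)], [X_(r+1)], [U]. The variable [X_(r-1)] is not rescaled: its power cancels against one
    from the image of [X_r]. *)
Let to_img (i : nat) : P :=
  if (i < r)%N then delta *: Y i else if i == r then Y i else
  if i == r.+1 then Y r.+2 - delta *: Y r else delta *: Y r.+1.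

Let from_img (i : nat) : P :=
  if (i < r)%N then delta^-1 *: Y i else if i == r then Y i else
  if i == r.+1 then delta^-1 *: Y r.+2 else Y r.+1 + delta *: Y r.

Let alpha : {lrmorphism P -> P} := comp_mpoly [tuple to_img i | i < r.+3].
Let beta : {lrmorphism P -> P} := comp_mpoly [tuple from_img i | i < r.+3].

Let alphaX i : (i < r.+3)%N -> alpha (Y i) = to_img i.
Proof.
by move=> ir; rewrite /alpha /= comp_mpolyXU -tnth_nth tnth_mktuple inordK.
Qed.

Let betaX i : (i < r.+3)%N -> beta (Y i) = from_img i.
Proof.
by move=> ir; rewrite /beta /= comp_mpolyXU -tnth_nth tnth_mktuple inordK.
Qed.

Let ord_cases3 (Q : nat -> Prop) :
    (forall i, (i < r)%N -> Q i) -> Q r -> Q r.+1 -> Q r.+2 ->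
  forall i : 'I_r.+3, Q i.
Proof.
move=> Qlow Q0 Q1 Q2 i; have ir := ltn_ord i.
have [/Qlow//|le_ri] := ltnP i r.
have [->//|n0] := eqVneq (i : nat) r; have [->//|n1] := eqVneq (i : nat) r.+1.
by rewrite (_ : (i : nat) = r.+2) //; lia.
Qed.

Let r0_lt : (r < r.+3)%N. Proof. by lia. Qed.
Let r1_lt : (r.+1 < r.+3)%N. Proof. by lia. Qed.
Let r2_lt : (r.+2 < r.+3)%N. Proof. by lia. Qed.
Let rr1 : (r.+1 < r)%N = false. Proof. by lia. Qed.
Let rr2 : (r.+2 < r)%N = false. Proof. by lia. Qed.
Let r1r : (r.+1 == r) = false. Proof. by lia. Qed.
Let r2r : (r.+2 == r) = false. Proof. by lia. Qed.
Let r2r1 : (r.+2 == r.+1) = false. Proof. by lia. Qed.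
Let rE := (ltnn, eqxx, rr1, rr2, r1r, r2r, r2r1).

Let alphaK : cancel alpha beta.
Proof.
apply: (@mpoly_lrmorphism_id _ _ (beta \o alpha)) => i /=.
rewrite -[i]inord_val; move: i.
apply: (ord_cases3 (Q := fun i => beta (alpha (Y i)) = Y i)).
- move=> i ir; have ir3 : (i < r.+3)%N by lia.
  rewrite alphaX // /to_img ir linearZ /= betaX // /from_img ir.
  by rewrite scalerA mulfV // scale1r.
- by rewrite alphaX // /to_img !rE betaX // /from_img !rE.
- rewrite alphaX // /to_img !rE linearB linearZ /= !betaX // /from_img !rE.
  by rewrite addrK.
- rewrite alphaX // /to_img !rE linearZ /= betaX // /from_img !rE.
  by rewrite scalerA mulfV // scale1r.
Qed.

Let betaK : cancel beta alpha.
Proof.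
apply: (@mpoly_lrmorphism_id _ _ (alpha \o beta)) => i /=.
rewrite -[i]inord_val; move: i.
apply: (ord_cases3 (Q := fun i => alpha (beta (Y i)) = Y i)).
- move=> i ir; have ir3 : (i < r.+3)%N by lia.
  rewrite betaX // /from_img ir linearZ /= alphaX // /to_img ir.
  by rewrite scalerA mulVf // scale1r.
- by rewrite betaX // /from_img !rE alphaX // /to_img !rE.
- rewrite betaX // /from_img !rE linearZ /= alphaX // /to_img !rE.
  by rewrite scalerA mulVf // scale1r.
- rewrite betaX // /from_img !rE linearD linearZ /= !alphaX // /to_img !rE.
  by rewrite subrK.
Qed.

Let alpha_hermitian :
  alpha (dehomogenize (Defs.hermitian k q r.+2)) = -1 *: Fpoly q r.+2 delta.
Proof.
have qcharP : [pchar P].-nat q by rewrite (eq_pnat _ (pchar_lalg _)).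
rewrite hermitian_affE rmorphD rmorph1 rmorph_sum /=.
rewrite (eq_bigr (fun i : 'I_r.+3 => to_img i ^+ q.+1)); last first.
  by move=> i _; rewrite rmorphXn /= -{1}[i]inord_val alphaX.
rewrite -(big_mkord xpredT (fun i => to_img i ^+ q.+1)).
rewrite !big_nat_recr //= big_nat.
rewrite (eq_bigr (fun i => - Y i ^+ q.+1)) => [|i /andP[_ ir]]; last first.
  by rewrite /to_img ir exprZn deltaE scaleN1r.
rewrite -big_nat sumrN /to_img !rE.
rewrite /Fpoly /Xlast /Xlow /Uvar /= big_add1 /= ord_max_inord.
(* Frobenius applies to the factor of exponent [q], which is a power of the characteristic. *)
rewrite [(_ - _) ^+ q.+1]exprS exprDn_pchar // exprNn_pchar // !exprZn deltaE.
rewrite !scaleN1r !exprS -!mul_mpolyC.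
(* The relation on [delta] is restated for constant polynomials, to simplify the one product that
   contains both [delta] and [delta ^+ q]. *)
have : (delta *: 1 : P) * (delta ^+ q *: 1) = -1.
  by rewrite -scalerAl mul1r scalerA -exprS deltaE scaleN1r.
rewrite -!mul_mpolyC !mulr1 => dE.
rewrite mulrBl !mulrBr [delta%:MP * _ * (_%:MP * _)]mulrACA dE mulN1r.
move: (\sum_(_ <= _ < _) _) => S; ring.
Qed.

Lemma hermitian_iso (fNU : dehomogenize (Defs.hermitian k q r.+2) \isn't a GRing.unit)
    (gNU : Fpoly q r.+2 delta \isn't a GRing.unit) :
  exists phi : {lrmorphism principal_quot fNU -> principal_quot gNU},
    bijective phi.
Proof.
by apply: (pquot_iso _ _ _ alphaK betaK alpha_hermitian); rewrite oppr_eq0 oner_neq0.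
Qed.

End ChangeOfCoordinates.

Theorem proposition2 (q r : nat) (qP : prime_power q) (r_ge2 : (2 <= r)%N)
    (k : finFieldType) (card_k : #|k| = (q ^ 2)%N)
    (delta : k) (deltaE : delta ^+ q.+1 = -1) :
  (exists rho : hermitian_coord_ring k q r -> option (value_semigroup q r),
     order_domain (@value_lt q r) rho) /\
  (exists phi : {lrmorphism hermitian_coord_ring k q r
                            -> presentation_ring qP r_ge2 delta},
     bijective phi).
Proof.
have [p [e [p_pr e_gt0 qE]]] := qP.
have q_ge2 : (2 <= q)%N.
  rewrite qE; apply: leq_trans (prime_gt1 p_pr) _.
  by rewrite -[X in (X <= _)%N]expn1 leq_pexp2l // prime_gt0.
(* Since [k] has q^2 elements, its characteristic is the prime dividing q. *)
have qchar : [pchar k].-nat q.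
  have p_char : p \in [pchar k].
    by apply: (card_finPcharP (n := (e * 2)%N)) p_pr; rewrite card_k qE expnM.
  by rewrite (eq_pnat _ (pcharf_eq p_char)) qE pnatX pnat_id.
have [phi phi_bij] : exists phi : {lrmorphism hermitian_coord_ring k q r
    -> presentation_ring qP r_ge2 delta}, bijective phi.
  by case: r r_ge2 => [|[|r']] // r_ge2'; apply: hermitian_iso.
split; last by exists phi.
(* The order function lives on the presentation and is pulled back along [phi]. *)
have [rho rhoP] := Fpoly_order_function q_ge2 r_ge2 deltaE
  (Fpoly_nonunit delta (prime_power_gt0 qP) r_ge2).
exists (rho \o phi); split; first exact: value_lt_wo.
exact: order_function_comp.
Qed.
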